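(* Let $k\ge1$ and $n\ge k$ be integers and let $\pi,\sigma\in D_k$. Label the blocks (strings) of $\pi$ as $\pi_1,\ldots,\pi_k$ and those of $\sigma$ as $\sigma_1,\ldots,\sigma_k$, and define ${\bf a}\in M_{k\times k}(\mathbb N)$ by $a_{ij}=\#\{r\in\{1,\ldots,2k\}: r\in\pi_i,\ r\in\sigma_j\}$ (so ${\bf a}$ has entries in $\{0,1,2\}$ and every row and column sums to $2$). Then $W_{kn}(\pi,\sigma)=I_n({\bf a})$.
   Context: $D_k$ is the set of pairings (partitions into blocks of size 2) of $\{1,\ldots,2k\}$. The Gram matrix $G_{kn}$ is the $D_k\times D_k$ matrix $G_{kn}(\pi,\sigma)=n^{|\pi\vee\sigma|}$, where $\pi\vee\sigma$ is the join in the lattice of set partitions and $|\cdot|$ is the number of blocks; for $n\ge k$ it is invertible and the Weingarten matrix is $W_{kn}=G_{kn}^{-1}$. For ${\bf a}=(a_{ij})\in M_{p\times q}(\mathbb N)$ with $p,q\le n$, $I_n({\bf a})=\int_{O_n}\prod_{i,j}u_{ij}^{a_{ij}}\,du$ with respect to the Haar probability measure on $O_n$. *)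

(* Defs.v *)
From HB Require Import structures.
From mathcomp Require Import all_boot all_order all_algebra.
From mathcomp Require Import all_classical all_reals all_analysis.
Set Implicit Arguments. Unset Strict Implicit. Unset Printing Implicit Defensive.
Import Order.TTheory GRing.Theory Num.Theory.

Local Open Scope nat_scope.

Definition is_pairing (k : nat) (P : {set {set 'I_(k.*2)}}) : bool :=
  finset.partition P (finset.setTfor (ordinal k.*2)) && [forall B in P, #|B| == 2].

Notation pairing k := {P : {set {set 'I_(k.*2)}} | is_pairing P}.

(* the join pi \/ sigma in the lattice of set partitions of [set: T]:
   the partition into connected components of the relation
   "x and y lie in a common block of pi or of sigma" *)
Definition pjoin_rel (T : finType) (P Q : {set {set T}}) : rel T :=
  fun x y => (finset.pblock P x == finset.pblock P y) || (finset.pblock Q x == finset.pblock Q y).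

Definition pjoin (T : finType) (P Q : {set {set T}}) : {set {set T}} :=
  equivalence_partition (connect (pjoin_rel P Q)) (finset.setTfor T).

Local Open Scope ring_scope.

Definition Gram (R : realType) (k n : nat) : 'M[R]_#|{: pairing k}| :=
  \matrix_(i, j) (n%:R ^+ #|pjoin (val (enum_val i)) (val (enum_val j))|).

Definition Weingarten (R : realType) (k n : nat) (p s : pairing k) : R :=
  invmx (Gram R k n) (enum_rank p) (enum_rank s).

Definition orthogonalmx (R : realType) (n : nat) (M : 'M[R]_n) : bool :=
  M *m trmx M == 1%:M.

Local Open Scope classical_set_scope.
(* Borel (product) sigma-algebra on n x n real matrices: generated by the
   coordinate maps M |-> M i j *)
Definition mxpt (R : realType) (n : nat) := 'M[R]_n.
HB.instance Definition _ (R : realType) (n : nat) := Choice.on (mxpt R n).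
HB.instance Definition _ (R : realType) (n : nat) :=
  isPointed.Build (mxpt R n) (0 : 'M[R]_n).

Definition mx_gen (R : realType) (n : nat) : set (set (mxpt R n)) :=
  fun A => exists (i j : 'I_n) (B : set R),
      measurable B /\ A = [set M : mxpt R n | B ((M : 'M[R]_n) i j)].

Definition MatSpace (R : realType) (n : nat) := g_sigma_algebraType (@mx_gen R n).

Definition is_Haar_On (R : realType) (n : nat)
    (mu : probability (MatSpace R n) R) : Prop :=
  mu [set M : MatSpace R n | orthogonalmx M] = 1%E /\
  forall (Q : 'M[R]_n), orthogonalmx Q ->
    forall A : set (MatSpace R n), measurable A ->
      mu [set M : MatSpace R n | A (Q *m M)] = mu A.

Definition haar_moment (R : realType) (n p q : nat) (hp : (p <= n)%N)
    (hq : (q <= n)%N) (mu : probability (MatSpace R n) R)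
    (a : 'I_p -> 'I_q -> nat) : \bar R :=
  (\int[mu]_(M in [set: MatSpace R n])
     (\prod_(i < p) \prod_(j < q)
        ((M : 'M[R]_n) (widen_ord hp i) (widen_ord hq j)) ^+ a i j)%:E)%E.

(* Main.v *)
Require Import Defs.
From HB Require Import structures.
From mathcomp Require Import all_boot all_order all_algebra.
From mathcomp Require Import perm ring.
From mathcomp Require Import all_classical all_reals all_analysis.
From mathcomp Require Import measurable_realfun.
Import Order.TTheory GRing.Theory Num.Theory.
Local Open Scope ring_scope.

(** For fixed [j], left invariance of the Haar measure makes
    [i |-> \int \prod_x u_(i x, j x)] an O(n)-invariant tensor of order [2k], and
    orthogonality of [u] makes its scalar product with the tensor [T_sigma] (the indicator
    of the [i] constant on the blocks of [sigma]) equal to [T_sigma(j)].  For [n >= k], the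
    first fundamental theorem for O(n) has an elementary proof: sign changes kill the
    entries with an odd fibre, permutation matrices show that entries depend only on the
    kernel of [i], and an infinitesimal rotation towards an unused basis vector splits
    large fibres; so an invariant tensor is determined by its entries at multi-indices
    whose kernel is a pairing, and these entries are its coefficients on the [T_pi].
    Pairing the resulting expansion with [T_sigma] gives [G *m C = 1], where [C] is the
    matrix of the moments in the statement; hence [C = W]. *)

(** * Preliminaries on products, kernels of maps and polynomials *)

Lemma prod_delta (R : comNzRingType) (I : finType) (b : I -> bool) :
  \prod_i (b i)%:R = [forall i, b i]%:R :> R.
Proof.
case: forallP => [h|h]; first by rewrite big1// => i _; rewrite h.
have [i /negbTE hi] : exists i, ~~ b i by apply/existsP; rewrite -negb_forall; apply/forallP.
by rewrite (bigD1 i)//= hi mul0r.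
Qed.

(** Induction on the number of points where [f] and [g] differ: composing [g] with the transposition
    of [f x] and [g x] repairs [x] and, the kernels being equal, spoils no point where they
    agree. *)
Lemma exists_perm_same_kernel (T V : finType) (f g : T -> V) :
  (forall x y, (f x == f y) = (g x == g y)) ->
  exists s : {perm V}, forall x, f x = s (g x).
Proof.
have [m] := ubnP #|[pred x | f x != g x]|; elim: m g => // m IH g hm fg.
have [/existsP[x xP]|/existsPn fgE] := boolP [exists x, f x != g x]; last first.
  by exists 1%g => x; rewrite perm1; apply/eqP; rewrite -[_ == _]negbK fgE.
pose g' y := tperm (f x) (g x) (g y).
have [||s hs] := IH g'; last first.
- by exists (tperm (f x) (g x) * s)%g => y; rewrite permM hs.
- by move=> y z; rewrite fg /g' (inj_eq perm_inj).
- rewrite ltnS in hm; apply: leq_trans hm; apply: proper_card; apply/properP; split.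
  + apply/fintype.subsetP => y; rewrite !inE /g'; apply: contraNN => /eqP fgy.
    rewrite -fgy; case: tpermP => // [fyx|fyx].
      by move/eqP: fyx; rewrite fg => /eqP <-; apply/eqP.
    have : g y == g x by rewrite -fgy fyx.
    by rewrite -fg.
  + by exists x; rewrite !inE // /g' tpermR eqxx.
Qed.

(** This is the Leibniz rule for the derivative at $0$. *)
Lemma coef1_prod (R : comNzRingType) (I : finType) (p : I -> {poly R}) :
  (\prod_i p i)`_1 = \sum_i (p i)`_1 * \prod_(j | j != i) (p j)`_0.
Proof.
have gen (r : seq I) : uniq r -> (\prod_(i <- r) p i)`_1 =
    \sum_(i <- r) (p i)`_1 * \prod_(j <- r | j != i) (p j)`_0.
  elim: r => [|x r IH]; first by rewrite !big_nil coef1.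
  move=> /= /andP[xr ur]; rewrite !big_cons coefM !big_ord_recr/= big_ord0 add0r subnn subn0.
  rewrite IH// eqxx/= addrC; congr (_ * _ + _).
    rewrite coef0_prod [RHS]big_seq_cond [LHS]big_seq; apply: eq_bigl => y.
    by case: (y \in r) (memPn xr y) => //= ->.
  rewrite big_distrr/= [RHS]big_seq [LHS]big_seq; apply: eq_bigr => y yr.
  rewrite big_cons ifT; first by rewrite mulrCA.
  by apply: contraNneq xr => ->.
exact/gen/index_enum_uniq.
Qed.

Lemma poly_eq0_ext (R : numDomainType) (p : {poly R}) :
  (forall x, p.[x] = 0) -> p = 0.
Proof.
move=> h; apply: (@roots_geq_poly_eq0 _ _ [seq i%:R | i <- iota 0 (size p)]).
- by apply/allP => x _; apply/rootP/h.
- by rewrite map_inj_uniq ?iota_uniq// => x y /eqP; rewrite eqr_nat => /eqP.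
- by rewrite size_map size_iota.
Qed.

(** * Tensors invariant under the orthogonal group *)

Section InvariantTensors.
Context {R : realType} {n : nat} {T : finType}.
Implicit Types (i j : {ffun T -> 'I_n}) (t : {ffun T -> 'I_n} -> R) (P : {set {set T}}).

(** [t] is the coordinate family of a tensor in $(R^n)^{\otimes T}$, required to be fixed by every
    $Q^{\otimes T}$ with $Q$ orthogonal. *)
Definition invariant_tensor t := forall Q : 'M[R]_n, orthogonalmx Q ->
  forall i, \sum_(j : {ffun T -> 'I_n}) (\prod_x Q (i x) (j x)) * t j = t i.

Definition upd i x v : {ffun T -> 'I_n} := [ffun y => if y == x then v else i y].

(** A row of a monomial matrix has a single possibly nonzero entry, so only the multi-index $f \circ
    i$ survives in the sum. This serves both permutation matrices and diagonal sign matrices. *)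
Lemma invariant_monomial t (f : 'I_n -> 'I_n) (d : 'I_n -> R) i :
  invariant_tensor t ->
  orthogonalmx (\matrix_(v, w) (d v * (w == f v)%:R) : 'M[R]_n) ->
  t i = (\prod_x d (i x)) * t [ffun x => f (i x)].
Proof.
move=> tinv /tinv/(_ i) <-.
under [LHS]eq_bigr => j _.
  under eq_bigr do rewrite mxE.
  rewrite big_split/= prod_delta; over.
rewrite (bigD1 [ffun x => f (i x)])//= [X in _ + X]big1 ?addr0 => [|j /eqP jf].
  by case: forallP => [_|[x]]; rewrite ?ffunE// mulr1n mulr1.
case: forallP => [h|_]; last by rewrite mulr0 mul0r.
by case: jf; apply/ffunP => x; rewrite ffunE; apply/eqP.
Qed.

Lemma invariant_perm t (s : {perm 'I_n}) i :
  invariant_tensor t -> t [ffun x => s (i x)] = t i.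
Proof.
move=> tinv; rewrite [RHS](@invariant_monomial _ s (fun=> 1))// ?big1 ?mul1r//.
apply/eqP/matrixP => v w; rewrite !mxE (bigD1 (s v))//= big1 => [|u /negbTE uv].
  by rewrite !mxE eqxx !mul1r addr0 (inj_eq perm_inj).
by rewrite !mxE uv mulr0 mul0r.
Qed.

(** Changing the sign of the basis vector of index [a] gives [t i = - t i]. *)
Lemma invariant_odd_fibre t i a :
  invariant_tensor t -> odd #|[pred x | i x == a]| -> t i = 0.
Proof.
move=> tinv odda.
have := @invariant_monomial t id (fun v => if v == a then -1 else 1) i tinv.
rewrite -big_mkcond prodr_const/= -signr_odd odda expr1 mulN1r.
rewrite (_ : [ffun x => i x] = i); last by apply/ffunP => x; rewrite ffunE.
move=> h; apply/eqP; rewrite -[_ == _](@mulrn_eq0 _ _ 2) mulr2n -[X in X + _]opprK -h ?addNr//.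
apply/eqP/matrixP => v w; rewrite !mxE (bigD1 v)//= big1 => [|u /negbTE uv].
  rewrite !mxE eqxx; case: (eqVneq v w) => [->|_]; last by rewrite mulr0n !mulr0 addr0.
  by case: ifP; rewrite ?(mul1r, mulrNN, mulr1, addr0).
by rewrite !mxE uv mulr0 mul0r.
Qed.

(** With [D] the projection on the plane and [J] a quarter turn in it, $D^2 = D$, $DJ = JD = J$ and
    $J^2 = -D$, so the product with the transpose is $1 + (c^2 + s^2 - 1) D$. *)
Lemma rotation_orthogonal (a b : 'I_n) (c s : R) : a != b -> c ^+ 2 + s ^+ 2 = 1 ->
  orthogonalmx (1%:M + (c - 1) *: (delta_mx a a + delta_mx b b)
                + s *: (delta_mx a b - delta_mx b a) : 'M[R]_n).
Proof.
move=> /negbTE ab cs; set D := delta_mx a a + _; set J := delta_mx a b - _.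
have ba : (b == a) = false by rewrite eq_sym.
have DT : D^T = D by rewrite linearD/= !trmx_delta.
have JT : J^T = - J by rewrite linearB/= !trmx_delta opprB.
have simpl := (mulmxDl, mulmxDr, mulmxBl, mulmxBr, mulNmx, mulmxN, mul_delta_mx_cond, eqxx, ab, ba).
have DD : D *m D = D by rewrite !simpl !mulr0n !mulr1n addr0 add0r.
have DJ : D *m J = J by rewrite !simpl !mulr0n !mulr1n ?addr0 ?add0r ?subr0 ?sub0r.
have JD : J *m D = J by rewrite !simpl !mulr0n !mulr1n ?addr0 ?add0r ?subr0 ?sub0r.
have JJ : J *m J = - D.
  by rewrite !simpl !mulr0n !mulr1n ?addr0 ?add0r ?subr0 ?sub0r ?oppr0 ?addr0 -opprD.
clearbody D J; apply/eqP; rewrite !linearD/= !linearZ/= DT JT trmx1.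
rewrite !(mulmxDl, mulmxDr, mul1mx, mulmx1) -!scalemxAl.
rewrite !mulmxN DD DJ JD JJ opprK.
apply/matrixP => v w; rewrite !mxE.
transitivity ((v == w)%:R + (c ^+ 2 + s ^+ 2 - 1) * D v w); first by ring.
by rewrite cs subrr mul0r addr0.
Qed.

(** The Kronecker deltas force [j] to agree with [i] off [x], leaving only the value [v] of [j] at
    [x] free. *)
Lemma sum_upd (G : {ffun T -> 'I_n} -> R) i x :
  \sum_j G j * \prod_(y | y != x) (i y == j y)%:R = \sum_v G (upd i x v).
Proof.
rewrite (bigID (fun j => upd i x (j x) == j))/= [X in _ + X]big1 ?addr0 => [|j jP]; last first.
  suff [y /andP[yx /negbTE iy]] : exists y, (y != x) && (i y != j y).
    by rewrite (bigD1 y)//= iy mul0r mulr0.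
  apply/existsP; apply: contraNT jP; rewrite negb_exists => /forallP h.
  apply/eqP/ffunP => y; rewrite ffunE; case: eqVneq => [->//|yx].
  by move: (h y); rewrite yx negbK => /eqP.
rewrite (reindex_onto (upd i x) (fun j => j x))/=; last by move=> j /eqP.
apply: eq_big => [v|v _]; first by rewrite !ffunE !eqxx.
rewrite big1 ?mulr1// => y /negbTE yx.
by rewrite ffunE yx eqxx.
Qed.

(* First-order part in [x] of the invariance under the rotation of angle [2 arctan x]
   in the plane [(a, b)], after clearing the denominators [1 + x^2]. *)
Lemma invariant_rotation t i a b : invariant_tensor t -> a != b ->
  \sum_(x | i x == a) t (upd i x b) = \sum_(x | i x == b) t (upd i x a).
Proof.
move=> tinv ab.
pose J v w : R := (v == a)%:R * (w == b)%:R - (v == b)%:R * (w == a)%:R.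
pose D v w : R := (v == a)%:R * (w == a)%:R + (v == b)%:R * (w == b)%:R.
(* [q v w] is $1 + X^2$ times the rotation entry with $c = (1-X^2)/(1+X^2)$ and $s = 2X/(1+X^2)$.
   This rational parametrization turns invariance into a polynomial identity [p = 0]. *)
pose q v w : {poly R} :=
  (1 + 'X ^+ 2) * ((v == w)%:R)%:P - ((D v w *+ 2)%:P * 'X - (J v w *+ 2)%:P) * 'X.
pose p := \sum_(j : {ffun T -> 'I_n}) (t j)%:P * \prod_x q (i x) (j x)
          - (t i)%:P * (1 + 'X ^+ 2) ^+ #|T|.
have p0 : p = 0.
  apply: poly_eq0_ext => x.
  pose e : R := 1 + x ^+ 2.
  have e0 : e != 0 by rewrite gt_eqF// ltr_pwDl// sqr_ge0.
  pose c := (1 - x ^+ 2) / e; pose s := (x *+ 2) / e.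
  have cs : c ^+ 2 + s ^+ 2 = 1 by rewrite /c /s /e; field.
  have := tinv _ (rotation_orthogonal _ _ _ _ ab cs) i.
  rewrite /p !hornerE horner_sum => <-.
  apply/eqP; rewrite subr_eq0; apply/eqP.
  rewrite mulr_suml; apply: eq_bigr => j _.
  rewrite !hornerE horner_prod -/e mulrC mulrAC; congr (_ * _).
  rewrite -prodr_const -big_split/=; apply: eq_bigr => y _.
  rewrite /q !hornerE !mxE /D /J -!mulnb !natrM /c /s.
  by rewrite /e; field.
have coef1q v w : (q v w)`_1 = J v w *+ 2.
  rewrite /q !(coefD, coefN, coefMX, coefMC, coefC, coefX, coefXn, coef1)/=.
  by rewrite !(mulr0n, mulr0, mul0r, addr0, add0r, oppr0, sub0r, opprK).
have coef0q v w : (q v w)`_0 = (v == w)%:R.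
  rewrite /q !(coefD, coefN, coefMX, coefMC, coefC, coefX, coefXn, coef1)/=.
  by rewrite addr0 mul1r oppr0 addr0.
have : p`_1 = 0 by rewrite p0 coef0.
have sumJ x : \sum_v t (upd i x v) * (J (i x) v *+ 2)
    = ((i x == a)%:R * t (upd i x b) - (i x == b)%:R * t (upd i x a)) *+ 2.
  rewrite (bigD1 a)//= (bigD1 b)/= 1?eq_sym// big1 => [|v /andP[/negbTE va /negbTE vb]].
    by rewrite /J !eqxx (negbTE ab) (negbTE (_ : b != a)) 1?eq_sym// !mulr0n !mulr1n; ring.
  by rewrite /J va vb !mulr0 subrr mul0rn mulr0.
(* The power of $1 + X^2$ has no linear term, so [t i] drops out of the first-order identity. *)
rewrite /p coefB coef_sum coefCM -prodr_const coef1_prod [X in _ * X]big1 => [|x _]; last first.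
  by rewrite coefD coef1 coefXn addr0 mul0r.
rewrite mulr0 subr0; under eq_bigr => j _.
  rewrite coefCM coef1_prod mulr_sumr.
  under eq_bigr do rewrite mulrA; over.
rewrite exchange_big/=; under eq_bigr => x _.
  under eq_bigr => j _ do under [X in _ * X]eq_bigr do rewrite coef0q.
  under eq_bigr => j _ do rewrite coef1q.
  rewrite (sum_upd (fun j => t j * (J (i x) (j x) *+ 2))).
  under eq_bigr => v _ do rewrite {2}/upd ffunE eqxx.
  rewrite sumJ; over.
move/eqP; rewrite sumrMnl mulrn_eq0/= sumrB subr_eq0 => /eqP.
have indicator c d : \sum_x (i x == c)%:R * t (upd i x d) = \sum_(x | i x == c) t (upd i x d).
  by rewrite [RHS]big_mkcond; apply: eq_bigr => x _; case: eqP; rewrite ?mul1r ?mul0r.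
by rewrite !indicator.
Qed.

(* A fibre with at least three points [x0, ...] can be split: as fewer than [n] values
   are used, rotating towards an unused value [b] writes [t i] as a sum of values of [t]
   at families using strictly more values. *)
Lemma invariant_eq0 t : invariant_tensor t -> (#|T| <= n.*2)%N ->
  (forall i, (forall a, #|[pred x | i x == a]| \in [:: 0; 2]%N) -> t i = 0) ->
  forall i, t i = 0.
Proof.
move=> tinv Tn t0 i.
have [m] := ubnP #|[pred a | [forall x, i x != a]]|; elim: m i => // m IH i im.
have [/existsP[a odda]|/existsPn evn] := boolP [exists a, odd #|[pred x | i x == a]|].
  exact: invariant_odd_fibre odda.
have [/existsP[a a2]|/existsPn le2] := boolP [exists a, 2 < #|[pred x | i x == a]|]%N; last first.
  by apply: t0 => a; move: (evn a) (le2 a); case: #|_| => [|[|[|]]].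
(* If every value were used, each fibre would be even and nonempty, hence of size at least 2, and
   the one over [a] is larger: [T] would have more than $2n$ points. *)
have [b bP] : exists b, [forall x, i x != b].
  apply/existsP; apply: contraLR Tn => /existsPn used.
  have fibre c : (2 <= #|[pred x | i x == c]|)%N.
    move: (evn c) (used c); rewrite negb_forall => + /existsP[x]; rewrite negbK => + ix.
    by rewrite (cardD1 x) inE ix; case: #|_|.
  have card_fibre c : (\sum_(x | i x == c) 1 = #|[pred x | i x == c]|)%N by rewrite -sum1_card.
  rewrite -ltnNge -[leqRHS]sum1_card (partition_big i predT)//= (bigD1 a)//= card_fibre.
  have -> : n.*2 = (2 + \sum_(c < n | c != a) 2)%N.
    by rewrite -(bigD1 a (F := fun=> 2%N) (P := predT))//= sum_nat_const card_ord muln2.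
  rewrite -addSn leq_add// leq_sum// => c _; rewrite card_fibre; exact: fibre.
have /existsP[x0 ix0] : [exists x, i x == a].
  by apply: contraLR a2 => /existsPn h; rewrite eq_card0// => x; rewrite inE (negbTE (h x)).
have iNb := forallP bP.
have ab : a != b by rewrite -(eqP ix0).
have := @invariant_rotation t (upd i x0 b) a b tinv ab.
rewrite [X in _ = X](big_pred1 x0) => [|x]; last first.
  by rewrite ffunE/=; case: (eqVneq x x0) => _; rewrite ?eqxx// (negbTE (iNb _)).
have -> : upd (upd i x0 b) x0 a = i.
  by apply/ffunP => x; rewrite !ffunE; case: eqVneq => // ->; rewrite (eqP ix0).
move=> <-; apply: big1 => x; rewrite ffunE; case: (eqVneq x x0) => [_ /eqP ba|xx0 /eqP ix].
  by rewrite ba eqxx in ab.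
apply: IH; rewrite ltnS in im; apply: leq_trans im; apply: proper_card.
apply/properP; split; last first.
  exists b; rewrite ?inE//; apply/forallP => /(_ x).
  by rewrite !ffunE eqxx eqxx.
apply/fintype.subsetP => c; rewrite !inE => /forallP h; apply/forallP => y.
have [yP|] := boolP (y \in [:: x0; x]); last first.
  by rewrite !inE negb_or => /andP[yx0 yx]; move: (h y); rewrite !ffunE (negbTE yx) (negbTE yx0).
have -> : i y = a by move: yP; rewrite !inE => /orP[] /eqP ->//; apply/eqP.
(* A third point of the fibre keeps [a] in use after [x0] and [x] have moved to [b]. *)
have [z] : exists z, [&& i z == a, z != x0 & z != x].
  apply/existsP; apply: contraLR a2 => /existsPn hz.
  have -> : 2%N = #|pred2 x0 x| by rewrite card2 eq_sym xx0.
  rewrite -leqNgt; apply: subset_leq_card.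
  apply/fintype.subsetP => z; rewrite !inE => iz.
  by move: (hz z); rewrite iz/= negb_and !negbK.
by case/and3P => /eqP <- zx0 zx; move: (h z); rewrite !ffunE (negbTE zx) (negbTE zx0).
Qed.

End InvariantTensors.

(** * The tensors attached to set partitions *)

Section PartitionTensors.
Context {R : realType} {n : nat} {T : finType}.
Implicit Types (i j : {ffun T -> 'I_n}) (t : {ffun T -> 'I_n} -> R) (P : {set {set T}}).

(** The indicator of this condition is the tensor $T_P$; for a pairing it is the product over the
    blocks of $\sum_v e_v \otimes e_v$. *)
Definition constant_on P i :=
  [forall x, forall y, (finset.pblock P x == finset.pblock P y) ==> (i x == i y)].

Definition separates P i :=
  forall x y, (i x == i y) = (finset.pblock P x == finset.pblock P y).

Lemma constant_onP P i :
  reflect (forall x y, finset.pblock P x = finset.pblock P y -> i x = i y) (constant_on P i).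
Proof.
apply: (iffP forallP) => [h x y /eqP xy|h x].
  by move: (h x) => /forallP/(_ y); rewrite xy => /eqP.
by apply/forallP => y; apply/implyP => /eqP /h ->.
Qed.

(** The quotient map and a section of it, used to identify families constant on the blocks with
    functions of the block. *)
Lemma block_map P : finset.partition P finset.setT ->
  exists (b : T -> {B | B \in P}) (s : {B | B \in P} -> T),
    cancel s b /\ forall x, val (b x) = finset.pblock P x.
Proof.
case/and3P => /eqP cov triv nz.
have mem x : finset.pblock P x \in P by rewrite finset.pblock_mem// cov finset.in_setT.
have /fin_all_exists[s sP] (B : {B | B \in P}) : exists x, finset.pblock P x = val B.
  have [x xB] : exists x, x \in val B.
    by apply/finset.set0Pn; apply: contraNneq nz => <-; exact: valP.
  by exists x; apply: finset.def_pblock => //; exact: valP.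
exists (fun x => exist (fun B => B \in P) _ (mem x)), s; split => // B.
by apply: val_inj; exact: sP.
Qed.

Lemma sum_factor (I : finType) (b : T -> I) (s : I -> T) (F : {ffun T -> 'I_n} -> R) :
  cancel s b ->
  \sum_(i : {ffun T -> 'I_n} | [forall x, forall y, (b x == b y) ==> (i x == i y)]) F i
  = \sum_(g : {ffun I -> 'I_n}) F [ffun x => g (b x)].
Proof.
move=> sK; rewrite (reindex_onto (fun g : {ffun I -> 'I_n} => [ffun x => g (b x)])
  (fun i : {ffun T -> 'I_n} => [ffun c => i (s c)]))/=; last first.
  move=> i /forallP h; apply/ffunP => x; rewrite !ffunE; apply/eqP.
  by move: (h (s (b x))) => /forallP/(_ x); rewrite sK eqxx.
apply: eq_bigl => g; apply/andP; split.
  apply/forallP => x; apply/forallP => y; apply/implyP => /eqP xy.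
  by rewrite !ffunE xy.
by apply/eqP/ffunP => c; rewrite !ffunE sK.
Qed.

Lemma sum_constant_on P (b : T -> {B | B \in P}) (s : {B | B \in P} -> T)
    (F : {ffun T -> 'I_n} -> R) :
  cancel s b -> (forall x, val (b x) = finset.pblock P x) ->
  \sum_(i | constant_on P i) F i
  = \sum_(g : {ffun {B | B \in P} -> 'I_n}) F [ffun x => g (b x)].
Proof.
move=> sK bP; rewrite -(sum_factor _ _ _ _ sK); apply: eq_bigl => i.
by apply: eq_forallb => x; apply: eq_forallb => y; rewrite -!bP (inj_eq val_inj).
Qed.

Lemma card_constant_on P : finset.partition P finset.setT ->
  \sum_i (constant_on P i)%:R = n%:R ^+ #|P| :> R.
Proof.
move=> /block_map[b [s [sK bP]]].
transitivity (\sum_(i | constant_on P i) 1 : R).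
  by rewrite [RHS]big_mkcond; apply: eq_bigr => i _; case: constant_on.
rewrite (sum_constant_on _ _ _ _ sK bP) sumr_const card_ffun card_ord card_sig natrX.
by congr (_ ^+ _); apply: eq_card.
Qed.

Lemma connect_pjoin_equivalence (P Q : {set {set T}}) :
  {in finset.setT & &, equivalence_rel (connect (pjoin_rel P Q))}.
Proof.
have rsym : symmetric (pjoin_rel P Q).
  by move=> u v; rewrite /pjoin_rel eq_sym [in X in _ || X]eq_sym.
apply: in3W; apply/equivalence_relP; split; first by move=> u; exact: connect0.
by move=> u v uv w; exact: (same_connect (sym_connect_sym rsym)).
Qed.

Lemma partition_pjoin (P Q : {set {set T}}) : finset.partition (pjoin P Q) finset.setT.
Proof. exact/finset.equivalence_partitionP/connect_pjoin_equivalence. Qed.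

Lemma pblock_pjoin (P Q : {set {set T}}) x y :
  (finset.pblock (pjoin P Q) x == finset.pblock (pjoin P Q) y) = connect (pjoin_rel P Q) x y.
Proof.
have req := connect_pjoin_equivalence P Q.
have /and3P[/eqP cov triv _] := partition_pjoin P Q.
rewrite finset.eq_pblock// ?cov ?finset.in_setT//.
by rewrite finset.pblock_equivalence_partition// finset.in_setT.
Qed.

(** Constancy propagates along a path of [pjoin_rel], each link of which stays in a block of [P] or
    of [Q]. *)
Lemma constant_on_pjoin (P Q : {set {set T}}) i :
  constant_on (pjoin P Q) i = constant_on P i && constant_on Q i.
Proof.
apply/constant_onP/andP => [h|[/constant_onP hP /constant_onP hQ] x y].
  split; apply/constant_onP => x y xy; apply: h; apply/eqP; rewrite pblock_pjoin connect1//.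
    by rewrite /pjoin_rel xy eqxx.
  by rewrite /pjoin_rel xy eqxx orbT.
move/eqP; rewrite pblock_pjoin => /connectP[r + ->].
elim: r x => //= z r IH x /andP[xz zr]; rewrite -(IH _ zr).
by case/orP: xz => /eqP; [exact: hP|exact: hQ].
Qed.

(** The entries of the Gram matrix are thus the scalar products of the $T_P$. *)
Lemma sum_constant_on2 (P Q : {set {set T}}) :
  \sum_i (constant_on P i)%:R * (constant_on Q i)%:R = n%:R ^+ #|pjoin P Q| :> R.
Proof.
rewrite -card_constant_on ?partition_pjoin//; apply: eq_bigr => i _.
by rewrite constant_on_pjoin -mulnb natrM.
Qed.

(** The sum factors over the blocks, and a block $\{x_1, x_2\}$ contributes the entry of $M^T M = 1$
    at $(j(x_1), j(x_2))$. *)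
Lemma sum_constant_on_prod P (M : 'M[R]_n) j :
  finset.partition P finset.setT -> {in P, forall B : {set T}, #|B| = 2%N} ->
  M^T *m M = 1%:M ->
  \sum_i (constant_on P i)%:R * (\prod_x M (i x) (j x)) = (constant_on P j)%:R.
Proof.
move=> part card2 MM; have [b [s [sK bP]]] := block_map _ part.
have /and3P[/eqP cov triv _] := part.
transitivity (\sum_(i | constant_on P i) \prod_x M (i x) (j x)).
  by rewrite [RHS]big_mkcond; apply: eq_bigr => i _; case: constant_on; rewrite ?mul1r ?mul0r.
rewrite (sum_constant_on _ _ _ _ sK bP).
under eq_bigr => g _.
  under eq_bigr do rewrite ffunE.
  rewrite (partition_big b predT)//=.
  under eq_bigr => c _ do under eq_bigr => x /eqP -> do over.
  over.
rewrite -(bigA_distr_bigA (fun c v => \prod_(x | b x == c) M v (j x))).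
have inB c x : (b x == c) = (x \in val c).
  rewrite -(inj_eq val_inj) bP; apply/eqP/idP => [<-|].
    by rewrite finset.mem_pblock cov finset.in_setT.
  by apply: finset.def_pblock => //; exact: valP.
have pair c : exists x1 x2, (forall x, (b x == c) = (x == x1) || (x == x2)) /\ x1 != x2.
  have /eqP/finset.cards2P[x1 [x2 [x12 cE]]] := card2 _ (valP c).
  by exists x1, x2; split => // x; rewrite inB cE finset.in_set2.
have prodE c : \sum_v \prod_(x | b x == c) M v (j x)
    = [forall x, forall y, [&& b x == c & b y == c] ==> (j x == j y)]%:R.
  have [x1 [x2 [bE x12]]] := pair c.
  transitivity ((M^T *m M) (j x1) (j x2)).
    rewrite mxE; apply: eq_bigr => v _.
    rewrite (bigD1 x1) ?bE ?eqxx//= (big_pred1 x2) ?mxE// => x.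
    by rewrite /= bE; case: (eqVneq x x1) => [->|_]; rewrite ?andbT ?(negbTE x12).
  rewrite MM mxE; congr (nat_of_bool _)%:R; apply/eqP/forallP => [jE x|/(_ x1)/forallP/(_ x2)].
    apply/forallP => y; apply/implyP; rewrite !bE.
    by move=> /andP[] /orP[] /eqP-> /orP[] /eqP->; rewrite ?jE.
  by rewrite !bE !eqxx orbT => /eqP.
under eq_bigr => c _ do rewrite prodE.
rewrite prod_delta; congr (nat_of_bool _)%:R.
apply/forallP/constant_onP => [h x y xy|h c].
  move: (h (b x)) => /forallP/(_ x)/forallP/(_ y); rewrite eqxx.
  by rewrite -(inj_eq val_inj) !bP xy eqxx => /eqP.
apply/forallP => x; apply/forallP => y; apply/implyP => /andP[/eqP bx /eqP yc].
by apply/eqP/h; rewrite -!bP bx yc.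
Qed.

Lemma invariant_constant_on P :
  finset.partition P finset.setT -> {in P, forall B : {set T}, #|B| = 2%N} ->
  invariant_tensor (fun i => (constant_on P i)%:R : R).
Proof.
move=> part card2 Q /eqP QQ i.
rewrite -[RHS](sum_constant_on_prod _ Q^T i part card2) ?trmxK//.
by apply: eq_bigr => j _; rewrite mulrC; congr (_ * _); apply: eq_bigr => x _; rewrite mxE.
Qed.

(** Each point receives the index of its block in an enumeration of [P]; the bound on [#|P|] makes
    these indices fit in ['I_n]. *)
Lemma exists_separating P : finset.partition P finset.setT -> (#|P| <= n)%N ->
  exists i, separates P i.
Proof.
case/and3P => /eqP cov triv _ Pn.
have mem x : finset.pblock P x \in P by rewrite finset.pblock_mem// cov finset.in_setT.
have idx x : (index (finset.pblock P x) (enum P) < n)%N.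
  by apply: leq_trans Pn; rewrite cardE index_mem mem_enum.
exists [ffun x => Ordinal (idx x)] => x y; rewrite !ffunE -val_eqE/=.
have pK z : nth finset.set0 (enum P) (index (finset.pblock P z) (enum P)) = finset.pblock P z.
  by rewrite nth_index// mem_enum.
by apply/eqP/eqP => [xy|->//]; rewrite -pK xy pK.
Qed.

(** Constancy on [P] puts each block of [P] inside a block of [Q], and both have two elements. *)
Lemma constant_on_separating (P Q : {set {set T}}) i :
  finset.partition P finset.setT -> {in P, forall B : {set T}, #|B| = 2%N} ->
  finset.partition Q finset.setT -> {in Q, forall B : {set T}, #|B| = 2%N} ->
  separates Q i -> constant_on P i = (P == Q).
Proof.
move=> /and3P[/eqP covP trP nzP] cardP /and3P[/eqP covQ trQ nzQ] cardQ sep.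
apply/constant_onP/eqP => [h|-> x y /eqP]; last by rewrite -sep => /eqP.
have memP x : finset.pblock P x \in P by rewrite finset.pblock_mem// covP finset.in_setT.
have memQ x : finset.pblock Q x \in Q by rewrite finset.pblock_mem// covQ finset.in_setT.
have PQ x : finset.pblock P x = finset.pblock Q x.
  apply/eqP; rewrite eqEcard (cardP _ (memP x)) (cardQ _ (memQ x)) andbT.
  apply/fintype.subsetP => y; rewrite -finset.eq_pblock ?covP ?finset.in_setT// => /eqP/h/eqP.
  by rewrite sep finset.eq_pblock// covQ finset.in_setT.
have blockE (S : {set {set T}}) B : finset.trivIset S -> finset.set0 \notin S -> B \in S ->
    exists x, finset.pblock S x = B.
  move=> tr nz BS; have [x xB] : exists x, x \in B.
    by apply/finset.set0Pn; apply: contraNneq nz => <-.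
  by exists x; apply: finset.def_pblock.
apply/finset.setP => B; apply/idP/idP => BS.
  by have [x <-] := blockE _ _ trP nzP BS; rewrite PQ.
by have [x <-] := blockE _ _ trQ nzQ BS; rewrite -PQ.
Qed.

(** The partition is the kernel of [i]: its blocks are the nonempty fibres. *)
Lemma fibre_pairing i : (forall a, #|[pred x | i x == a]| \in [:: 0; 2]%N) ->
  exists P, [/\ finset.partition P finset.setT, {in P, forall B : {set T}, #|B| = 2%N}
             & separates P i].
Proof.
move=> card02; exists (finset.preim_partition i finset.setT).
have part := finset.preim_partitionP i finset.setT.
have /and3P[/eqP cov triv nz] := part.
have req : {in finset.setT & &, equivalence_rel (fun x y => i x == i y)}.
  by apply: in3W => x y z; split => // /eqP ->.
have sep x y : (y \in finset.pblock (finset.preim_partition i finset.setT) x) = (i x == i y).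
  by rewrite finset.pblock_equivalence_partition// finset.in_setT.
split => // [B BP|x y]; last by rewrite finset.eq_pblock// cov finset.in_setT.
have [x xB] : exists x, x \in B by apply/finset.set0Pn; apply: contraNneq nz => <-.
rewrite -(finset.def_pblock triv BP xB).
have -> : #|finset.pblock (finset.preim_partition i finset.setT) x| = #|[pred y | i y == i x]|.
  by apply: eq_card => y; rewrite sep inE eq_sym.
have := card02 (i x); rewrite !inE (cardD1 x) inE eqxx => /orP[//|/eqP //].
Qed.

End PartitionTensors.

(** * Pairings and the inversion of the Gram matrix *)

Lemma pairingP k (p : pairing k) :
  finset.partition (val p) finset.setT /\ {in val p, forall B : {set 'I_(k.*2)}, #|B| = 2%N}.
Proof.
have /andP[part /forallP h] : is_pairing (val p) := valP p.
by split => // B Bp; apply/eqP; move: (h B); rewrite Bp.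
Qed.

Lemma card_pairing k (p : pairing k) : #|val p| = k.
Proof.
have [part card2] := pairingP k p.
have := finset.card_uniform_partition card2 part.
by rewrite finset.cardsT card_ord muln2 => /double_inj.
Qed.

Section WeingartenFormula.
Context {R : realType} {k n : nat} (kn : (k <= n)%N).
Implicit Types (i j : {ffun 'I_(k.*2) -> 'I_n}).

(** The difference of the two sides is invariant. At a multi-index whose kernel is a pairing [q],
    only the term of [q] survives, and a permutation of the values carries [rho q] to that
    multi-index; so the difference vanishes there, hence everywhere by [invariant_eq0]. *)
Lemma invariant_tensor_expand (t : {ffun 'I_(k.*2) -> 'I_n} -> R)
    (rho : pairing k -> {ffun 'I_(k.*2) -> 'I_n}) :
  invariant_tensor t -> (forall p, separates (val p) (rho p)) ->
  forall i, t i = \sum_(p : pairing k) (constant_on (val p) i)%:R * t (rho p).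
Proof.
move=> tinv sep i; apply/eqP; rewrite -subr_eq0; apply/eqP.
pose u i := t i - \sum_(p : pairing k) (constant_on (val p) i)%:R * t (rho p).
have uinv : invariant_tensor u.
  move=> Q QQ l; rewrite /u -(tinv Q QQ l).
  under eq_bigr do rewrite mulrBr.
  rewrite sumrB; congr (_ - _).
  under eq_bigr do rewrite mulr_sumr.
  rewrite exchange_big/=; apply: eq_bigr => p _.
  have [part card2] := pairingP k p.
  rewrite -(invariant_constant_on _ part card2 Q QQ l) mulr_suml.
  by apply: eq_bigr => j _; rewrite mulrA.
rewrite -/(u i); apply: invariant_eq0 => //; first by rewrite card_ord leq_double.
move=> j /fibre_pairing[P [part card2 sepj]].
have Ppair : is_pairing P.
  by rewrite /is_pairing part; apply/forallP => B; apply/implyP => /card2 ->.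
pose q : pairing k := exist _ P Ppair.
rewrite /u (bigD1 q)//= big1 ?addr0 => [|p pq]; last first.
  have [ppart pcard2] := pairingP k p.
  rewrite (constant_on_separating _ _ _ ppart pcard2 part card2 sepj).
  by rewrite -[P]/(val q) (inj_eq val_inj) (negbTE pq) mul0r.
rewrite (constant_on_separating _ _ _ part card2 part card2 sepj) eqxx mul1r.
have [x y|s js] := exists_perm_same_kernel _ _ j (rho q); first by rewrite sepj sep.
rewrite -(invariant_perm t s (rho q) tinv) (_ : [ffun x => s (rho q x)] = j) ?subrr//.
by apply/ffunP => x; rewrite ffunE js.
Qed.

(* The two hypotheses on [F] say that [F^~ j] is the orthogonal projection of the basis
   tensor [e_j] on the space of invariant tensors. *)
Lemma WeingartenE (F : {ffun 'I_(k.*2) -> 'I_n} -> {ffun 'I_(k.*2) -> 'I_n} -> R)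
    (rho kap : pairing k -> {ffun 'I_(k.*2) -> 'I_n}) p s :
  (forall j, invariant_tensor (F^~ j)) ->
  (forall (q : pairing k) j,
    \sum_i (constant_on (val q) i)%:R * F i j = (constant_on (val q) j)%:R) ->
  (forall q, separates (val q) (rho q)) -> (forall q, separates (val q) (kap q)) ->
  Weingarten R n p s = F (rho p) (kap s).
Proof.
move=> Finv Fproj rsep ksep.
pose C : 'M[R]_#|{: pairing k}| :=
  \matrix_(a, b) F (rho (enum_val a)) (kap (enum_val b)).
have GC : Gram R k n *m C = 1%:M.
  apply/matrixP => a b; rewrite !mxE.
  under eq_bigr do rewrite !mxE.
  rewrite -(big_enum_val (A := {: pairing k}) (fun q =>
    n%:R ^+ #|pjoin (val (enum_val a)) (val q)| * F (rho q) (kap (enum_val b)))) /=.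
  (* Writing the Gram entry as a scalar product and exchanging the sums makes the expansion of the
     invariant tensor [F^~ (kap (enum_val b))] appear inside. *)
  under eq_bigr do rewrite -sum_constant_on2 mulr_suml.
  rewrite exchange_big/=.
  under eq_bigr => i _.
    under eq_bigr do rewrite -mulrA.
    rewrite -mulr_sumr -(invariant_tensor_expand _ _ (Finv (kap (enum_val b))) rsep); over.
  rewrite Fproj.
  have [apart acard] := pairingP k (enum_val a).
  have [bpart bcard] := pairingP k (enum_val b).
  rewrite (constant_on_separating _ _ _ apart acard bpart bcard (ksep _)).
  by rewrite (inj_eq val_inj) (inj_eq enum_val_inj).
(* The right inverse makes the Gram matrix a unit, so [invmx] is a true inverse here, not its
   default value. *)
have [Gu _] := mulmx1_unit GC.
by rewrite /Weingarten -[invmx _]mulmx1 -GC mulKmx// mxE !enum_rankK.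
Qed.

End WeingartenFormula.

(** * Moments of the Haar measure *)

Section HaarMoments.
Local Open Scope classical_set_scope.
Context {R : realType} {n : nat}.

Lemma measurable_entry (a b : 'I_n) :
  measurable_fun setT (fun M : MatSpace R n => (M : 'M[R]_n) a b).
Proof.
move=> _ B mB; rewrite setTI; apply: sub_gen_smallest.
by exists a, b, B.
Qed.

Lemma measurable_mulmx (Q : 'M[R]_n) :
  measurable_fun setT (fun M : MatSpace R n => Q *m M : MatSpace R n).
Proof.
apply: (measurability (@mx_gen R n : set (set (MatSpace R n)))) => // _ [_ [a [b [B [mB ->]]]] <-].
have -> : (fun M : MatSpace R n => Q *m M : MatSpace R n) @^-1`
    [set M : mxpt R n | B ((M : 'M[R]_n) a b)]
    = (fun M : MatSpace R n => \sum_c Q a c * (M : 'M[R]_n) c b) @^-1` B.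
  by apply/seteqP; split => M /=; rewrite mxE.
apply: measurable_sum => // c; apply: measurable_funM => //; exact: measurable_entry.
Qed.

(** The orthogonality equations are condensed into the vanishing of one measurable function, the sum
    of the squared entries of $M M^T - 1$. *)
Lemma measurable_orthogonalmx :
  measurable ([set M | orthogonalmx M] : set (MatSpace R n)).
Proof.
have dotE (M : 'M[R]_n) a b : \sum_c M a c * M b c = (M *m M^T) a b.
  by rewrite mxE; apply: eq_bigr => c _; rewrite mxE.
have -> : [set M : MatSpace R n | orthogonalmx M] = setT `&`
    (fun M : MatSpace R n => \sum_a \sum_b
       (\sum_c (M : 'M[R]_n) a c * (M : 'M[R]_n) b c - (a == b)%:R) ^+ 2) @^-1` [set 0].
  rewrite setTI; apply/seteqP; split => M /=.
    move=> /eqP MM; apply: big1 => a _; apply: big1 => b _.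
    by rewrite dotE MM mxE subrr expr0n.
  move/eqP; rewrite psumr_eq0 => [/allP h|a _]; last by apply: sumr_ge0 => b _; exact: sqr_ge0.
  apply/eqP/matrixP => a b; move: (h a (mem_index_enum _)).
  rewrite psumr_eq0 => [/allP hb|c _]; last exact: sqr_ge0.
  by move: (hb b (mem_index_enum _)); rewrite sqrf_eq0 subr_eq0 dotE => /eqP ->; rewrite mxE.
suff : measurable_fun setT (fun M : MatSpace R n => \sum_a \sum_b
    (\sum_c (M : 'M[R]_n) a c * (M : 'M[R]_n) b c - (a == b)%:R) ^+ 2) by apply.
apply: measurable_sum => a; apply: measurable_sum => b.
apply: measurable_funX; apply: measurable_funB => //.
by apply: measurable_sum => c; apply: measurable_funM; exact: measurable_entry.
Qed.

Lemma orthogonalmx_entry_le1 (M : 'M[R]_n) a b : orthogonalmx M -> `|M a b| <= 1.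
Proof.
move=> /eqP/matrixP/(_ a a); rewrite !mxE eqxx mulr1n (bigD1 b)//= mxE -expr2 => h.
rewrite -(ler_pXn2r (n := 2))// ?nnegrE// expr1n real_normK ?num_real// -h.
by rewrite lerDl sumr_ge0// => c _; rewrite mxE -expr2 sqr_ge0.
Qed.

Context {T : finType}.
Implicit Types (i j : {ffun T -> 'I_n}).

Definition entry_monomial i j (M : MatSpace R n) : R :=
  \prod_x (M : 'M[R]_n) (i x) (j x).

Lemma measurable_entry_monomial i j : measurable_fun setT (entry_monomial i j).
Proof. by apply: measurable_prod => x _; exact: measurable_entry. Qed.

Context (mu : probability (MatSpace R n) R) (hmu : is_Haar_On mu).

(** Since [mu] lives on all matrices, facts about orthogonal matrices enter the integrals only
    almost everywhere. *)
Lemma ae_orthogonalmx (P : set (MatSpace R n)) :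
  (forall M : 'M[R]_n, orthogonalmx M -> P M) -> \forall M \ae mu, P M.
Proof.
move=> OP; exists (~` [set M : MatSpace R n | orthogonalmx M]); split.
- by apply: measurableC; exact: measurable_orthogonalmx.
- rewrite probability_setC; last exact: measurable_orthogonalmx.
  by rewrite hmu.1 subee.
- by apply: subsetC => M; exact: OP.
Qed.

Lemma integrable_entry_monomial i j :
  mu.-integrable setT (EFin \o entry_monomial i j).
Proof.
have mf := measurable_entry_monomial i j.
apply/integrableP; split; first exact/measurable_EFinP.
apply: (@le_lt_trans _ _ (\int[mu]_(M in setT) cst 1%E M)%E); last first.
  rewrite integral_cst// mul1e.
  by rewrite (_ : _ setT = 1%E) ?ltry//; exact: (@probability_setT _ _ _ mu).
apply: ae_ge0_le_integral => //.
- by apply: measurableT_comp => //; exact/measurable_EFinP.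
- apply: ae_orthogonalmx => M OM _ /=.
  rewrite lee_fin normr_prod; apply: prodr_ile1 => x _.
  by rewrite normr_ge0 orthogonalmx_entry_le1.
Qed.

(** [fine] loses nothing: the monomials are almost everywhere bounded by 1, so the integral is
    finite. *)
Definition entry_moment i j : R := fine (\int[mu]_M (entry_monomial i j M)%:E).

Lemma entry_momentE i j : (\int[mu]_M (entry_monomial i j M)%:E)%E = (entry_moment i j)%:E.
Proof.
by rewrite fineK//; apply: integrable_fin_num => //; exact: integrable_entry_monomial.
Qed.

Lemma integral_lin_monomial (c : {ffun T -> 'I_n} -> R) j :
  (\int[mu]_M (\sum_i c i * entry_monomial i j M)%:E)%E
  = (\sum_i c i * entry_moment i j)%:E.
Proof.
under eq_integral do rewrite -sumEFin.
have int i : mu.-integrable setT (fun M => (c i * entry_monomial i j M)%:E).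
  under eq_fun do rewrite EFinM.
  by apply: integrableZl => //; exact: integrable_entry_monomial.
rewrite integral_sum// -sumEFin; apply: eq_bigr => i _.
under eq_integral do rewrite EFinM.
by rewrite integralZl ?entry_momentE//; exact: integrable_entry_monomial.
Qed.

(** The combination of monomials in $M$ is the monomial $(i, j)$ of $QM$; its integral is one
    against the image of [mu] under left multiplication by $Q$, which is [mu]. *)
Lemma invariant_entry_moment j : invariant_tensor (entry_moment^~ j).
Proof.
move=> Q OQ i; apply: EFin_inj; rewrite -integral_lin_monomial -entry_momentE.
pose phi (M : MatSpace R n) : MatSpace R n := Q *m M.
have mphi : measurable_fun setT phi by exact: measurable_mulmx.
have expand M : \sum_(i' : {ffun T -> 'I_n}) (\prod_x Q (i x) (i' x)) * entry_monomial i' j M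
    = entry_monomial i j (phi M).
  rewrite /entry_monomial /phi; under [RHS]eq_bigr do rewrite mxE.
  by rewrite bigA_distr_bigA/=; apply: eq_bigr => i' _; rewrite -big_split.
transitivity (\int[mu]_M (entry_monomial i j (phi M))%:E)%E.
  by apply: eq_integral => M _; rewrite expand.
have int : mu.-integrable setT (fun M => (entry_monomial i j (phi M))%:E).
  rewrite (_ : (fun M => _) = (fun M => \sum_(i' : {ffun T -> 'I_n})
      (\prod_x Q (i x) (i' x))%:E * (entry_monomial i' j M)%:E)%E); last first.
    by apply/funext => M; rewrite -expand -sumEFin.
  apply: integrable_sum => // i' _; apply: integrableZl => //.
  exact: integrable_entry_monomial.
have := @integral_pushforward _ _ _ _ _ phi mphi mu setT (EFin \o entry_monomial i j).
rewrite preimage_setT => <- //; last by apply/measurable_EFinP; exact: measurable_entry_monomial.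
by apply: eq_measure_integral => A mA _; exact: hmu.2.
Qed.

Lemma entry_moment_constant_on (P : {set {set T}}) j :
  finset.partition P finset.setT -> {in P, forall B : {set T}, #|B| = 2%N} ->
  \sum_i (constant_on P i)%:R * entry_moment i j = (constant_on P j)%:R.
Proof.
move=> part card2; apply: EFin_inj; rewrite -integral_lin_monomial.
rewrite (ae_eq_integral (cst (constant_on P j)%:R%:E))//=.
- by rewrite integral_cst// (_ : _ setT = 1%E) ?mule1//; exact: (@probability_setT _ _ _ mu).
- apply/measurable_EFinP; apply: measurable_sum => i.
  by apply: measurable_funM => //; exact: measurable_entry_monomial.
- apply: ae_orthogonalmx => M /eqP OM _ /=.
  (* [orthogonalmx] provides $M M^T = 1$, whereas the columns require $M^T M = 1$. *)
  by rewrite sum_constant_on_prod//; apply: mulmx1C.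
Qed.

End HaarMoments.

(** * Labelled strings and the moment of the statement *)

Lemma pairing_labelling k (p : pairing k) (l : 'I_k -> {set 'I_(k.*2)}) :
  injective l -> (forall c, l c \in val p) ->
  exists f : 'I_(k.*2) -> 'I_k, (forall x c, (x \in l c) = (f x == c)) /\
    forall x y, (f x == f y) = (finset.pblock (val p) x == finset.pblock (val p) y).
Proof.
move=> linj lp; have [/and3P[/eqP cov triv _] _] := pairingP k p.
(* As a pairing has exactly [k] blocks, [k] distinct ones exhaust it, so every point gets a
   label. *)
have lE : [set l c | c in 'I_k]%SET = val p.
  apply/eqP; rewrite eqEcard card_imset// card_ord card_pairing leqnn andbT.
  by apply/fintype.subsetP => _ /finset.imsetP[c _ ->].
have /fin_all_exists[f fP] (x : 'I_(k.*2)) : exists c, x \in l c.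
  have /finset.imsetP[c _ xc] : finset.pblock (val p) x \in [set l c | c in 'I_k]%SET.
    by rewrite lE finset.pblock_mem// cov finset.in_setT.
  exists c.
  by rewrite -xc finset.mem_pblock cov finset.in_setT.
have lf x : l (f x) = finset.pblock (val p) x by rewrite (finset.def_pblock triv (lp _) (fP x)).
exists f; split => [x c|x y]; last by rewrite -!lf (inj_eq linj).
by rewrite -(inj_eq linj) lf; apply/idP/eqP => [/(finset.def_pblock triv (lp _))//|<-];
   rewrite finset.mem_pblock cov finset.in_setT.
Qed.

(** [WeingartenE] needs a representative for every pairing; the one at [p] must be the multi-index
    of the given labelling. *)
Lemma exists_separating_family {k n : nat} (kn : (k <= n)%N) (p : pairing k)
    (i : {ffun 'I_(k.*2) -> 'I_n}) : separates (val p) i ->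
  exists rho : pairing k -> {ffun 'I_(k.*2) -> 'I_n},
    rho p = i /\ forall q, separates (val q) (rho q).
Proof.
move=> sepi.
have /fin_all_exists[r rP] (q : pairing k) :
    exists j : {ffun 'I_(k.*2) -> 'I_n}, separates (val q) j.
  by apply: exists_separating; [case: (pairingP k q)|rewrite card_pairing].
exists (fun q => if q == p then i else r q); split; first by rewrite eqxx.
by move=> q; case: eqP => [->|_].
Qed.

Theorem theorem2p3 (R : realType) (k n : nat) (hk : (1 <= k)%N)
    (hkn : (k <= n)%N) (p s : pairing k)
    (lp ls : 'I_k -> {set 'I_(k.*2)})
    (lp_inj : injective lp) (lp_in : forall i, lp i \in val p)
    (ls_inj : injective ls) (ls_in : forall j, ls j \in val s)
    (mu : probability (MatSpace R n) R) (hmu : is_Haar_On mu) :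
  haar_moment hkn hkn mu (fun i j => #|lp i :&: ls j|)
  = (Weingarten R n p s)%:E.
Proof.
have [f [fP fsep]] := pairing_labelling _ _ _ lp_inj lp_in.
have [g [gP gsep]] := pairing_labelling _ _ _ ls_inj ls_in.
(* The multi-indices send a point to the labels of its strings, so their kernels are [p] and [s]. *)
pose i : {ffun 'I_(k.*2) -> 'I_n} := [ffun x => widen_ord hkn (f x)].
pose j : {ffun 'I_(k.*2) -> 'I_n} := [ffun x => widen_ord hkn (g x)].
have isep : separates (val p) i by move=> x y; rewrite !ffunE -fsep.
have jsep : separates (val s) j by move=> x y; rewrite !ffunE -gsep.
have [rho [rhop rhoP]] := exists_separating_family hkn _ _ isep.
have [kap [kaps kapP]] := exists_separating_family hkn _ _ jsep.
rewrite (WeingartenE hkn (entry_moment mu) rho kap)//; last 2 first.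
- by move=> l; exact: invariant_entry_moment.
- by move=> q l; have [part card2] := pairingP k q; exact: entry_moment_constant_on.
rewrite rhop kaps -entry_momentE//; apply: eq_integral => M _; congr (_%:E).
(* Grouping the points by their pair of labels [(c, d)] collects the exponent [#|lp c :&: ls d|]. *)
rewrite /entry_monomial (partition_big f predT)//=; apply: eq_bigr => c _.
rewrite (partition_big g predT)//=; apply: eq_bigr => d _.
rewrite -prodr_const; apply: eq_big => x; rewrite finset.in_setI fP gP//.
by move=> /andP[/eqP <- /eqP <-]; rewrite !ffunE.
Qed.
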